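(* Let $(X,\mu)$ be a probability space, $T:X\to X$ a measure preserving transformation, $\mathcal{A}=\{A_i\}_{i\in\mathbb{N}}$ a measurable partition of $X$, and $g:\mathbb{N}\to[0,\infty)$ a function with $g(N)=o(N)$ such that $$\sum_{n=0}^N\left(\frac{\mu(A_i\cap T^{-n}A_j)}{\mu (A_i)\mu (A_j)}-1\right)\le g(N)\quad\text{for all } i,j,N\in\mathbb{N}.$$ Let $G(N)=\sum_{n=1}^Ng(n)$. If $f\in\mathrm{L}^2(X,\mu)$ is measurable with respect to (the $\sigma$-algebra generated by) $\mathcal{A}$, and if $$g(N+1)\ll (N+G(N))^{2/3},$$ then for every $\epsilon>0$ and for $\mu$-almost every $x\in X$ we have that $$\frac{1}{N}\sum_{n=0}^{N-1}f(T^nx)=\int_Xf\,d\mu+O_\epsilon\left(N^{-1}(N+G(N))^{2/3}\log^{1/3+\epsilon}(N+G(N))\right).$$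
   Context: $\mathbb{N}=\{1,2,\dots\}$. The displayed inequality bounding the sum by $g(N)$ is understood for those $i,j$ with $\mu(A_i),\mu(A_j)>0$. $\log^a u$ means $(\log u)^a$. $u(N)\ll v(N)$ means $|u(N)|\le C\,v(N)$ with a constant $C$ independent of $N$. The pointwise almost-everywhere estimate is understood as $N\to\infty$: for a.e. fixed $x$, the implied constant in $O_\epsilon$ does not depend on $N$ but may depend on $\epsilon$, on $x$, and on the data $X,\mu,T,\mathcal{A},g,f$. *)

(* Defs.v *)
(* MathComp-Analysis *)
From HB Require Import structures.
From mathcomp Require Export all_boot all_order all_algebra.
From mathcomp Require Export all_classical all_reals all_analysis.

Set Implicit Arguments.
Unset Strict Implicit.
Unset Printing Implicit Defensive.

Export Order.TTheory GRing.Theory Num.Theory.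
Export numFieldNormedType.Exports.

Local Open Scope classical_set_scope.
Local Open Scope ring_scope.

Definition measure_preserving (d : measure_display) (X : measurableType d)
    (R : realType) (mu : {measure set X -> \bar R}) (T : X -> X) : Prop :=
  measurable_fun [set: X] T /\
  forall A : set X, measurable A -> mu (T @^-1` A) = mu A.

(* Empty and null cells are allowed, so that finite partitions are covered.
   The index set of the cells is all of nat, a relabelling of {1, 2, ...}. *)
Definition measurable_partition (d : measure_display) (X : measurableType d)
    (A : nat -> set X) : Prop :=
  [/\ forall i, measurable (A i),
      trivIset [set: nat] A &
      \bigcup_i A i = [set: X]].

Definition measurable_wrt (d : measure_display) (X : measurableType d)
    (R : realType) (A : nat -> set X) (f : X -> R) : Prop :=
  measurable_fun [set: g_sigma_algebraType (range A)]
    (f : g_sigma_algebraType (range A) -> R).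

(* iter n T @^-1` B is T^{-n} B; fine is harmless as mu takes values in
   [0, 1]. *)
Definition mixing_ratio (d : measure_display) (X : measurableType d)
    (R : realType) (mu : probability X R) (T : X -> X) (B C : set X)
    (n : nat) : R :=
  fine (mu (B `&` iter n T @^-1` C)) / (fine (mu B) * fine (mu C)).

Definition Gsum (R : realType) (g : nat -> R) (N : nat) : R :=
  \sum_(1 <= n < N.+1) g n.

Definition birkhoff_average (X : Type) (R : realType) (T : X -> X)
    (f : X -> R) (x : X) (N : nat) : R :=
  N%:R^-1 * \sum_(0 <= n < N) f (iter n T x).

(* Main.v *)
Require Import Defs.
From mathcomp Require Import measurable_realfun ring lra.

(* Splitting f into positive and negative parts, assume f >= 0, and put
   m = \int f, D_N = S_N - N m and Phi(N) = N + G(N).  Summing the mixing bound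
   over pairs of cells with the nonnegative weights given by the values of f
   yields \int f S_{N+1} <= (N + 1 + g(N)) m^2, whence \int D_N^2 = O(Phi(N)).
   With p = 3 eps the series over M of
     ((ln Phi(M))^-p - (ln Phi(M+1))^-p) / Phi(M+1) * D_{M+1}^2
   then has a telescoping bound on its integral, so it is finite almost
   everywhere.  At such a point D_N = O(Phi(N)^(2/3) ln^(1/3+eps) Phi(N)): since
   f >= 0, D decreases by at most m per step, so a large |D_N| persists over a
   block of indices on which Phi varies by the claimed rate e, and such a block
   contributes about D_N^2 e / (Phi^2 ln^(1+p) Phi) = (D_N / e)^2 to the series.
   The growth condition on g keeps Phi from jumping by more than O(e). *)

Set Implicit Arguments.
Unset Strict Implicit.
Unset Printing Implicit Defensive.

Local Open Scope classical_set_scope.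
Local Open Scope ring_scope.

(** * Tangent-line inequalities for powers and logarithms *)

Lemma ln_le_subr1 (R : realType) (x : R) : 0 < x -> ln x <= x - 1.
Proof.
by move=> x0; rewrite -[X in ln X](subrKC 1) le_ln1Dx//; lra.
Qed.

(** Convexity of t^(-p): its graph lies above the tangent at [y]. *)
Lemma powRN_gain (R : realType) (p x y : R) : 0 < p -> 0 < x -> x <= y ->
  p * (y - x) / y `^ (1 + p) <= x `^ (- p) - y `^ (- p).
Proof.
move=> p0 x0 xy; have y0 : 0 < y by exact: lt_le_trans xy.
have r0 : 0 < x / y by exact: divr_gt0.
have -> : x `^ (- p) = y `^ (- p) * (x / y) `^ (- p).
  by rewrite -powRM ?(ltW y0) ?(ltW r0)// mulrCA divff ?gt_eqF// mulr1.
have -> : y `^ (1 + p) = y * y `^ p.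
  by rewrite powRD ?powRr1 ?(ltW y0)// (gt_eqF y0) implybT.
rewrite [y `^ (- p)]powRN.
set u := y `^ p; have u0 : 0 < u by exact: powR_gt0.
have h : 1 + p * (1 - x / y) <= (x / y) `^ (- p).
  rewrite /powR gt_eqF//; apply: le_trans (expR_ge1Dx _).
  by rewrite lerD2l mulNr -mulrN ler_pM2l//; have := ln_le_subr1 r0; lra.
have -> : p * (y - x) / (y * u) = u^-1 * (p * (1 - x / y)).
  by field; rewrite !gt_eqF.
have v0 : 0 < u^-1 by rewrite invr_gt0.
rewrite -[leRHS](_ : u^-1 * ((x / y) `^ (- p) - 1) = _); last first.
  by rewrite mulrBr mulr1.
by rewrite ler_pM2l//; lra.
Qed.

(** The previous bound at [ln a] and [ln b], combined with ln b - ln a >= (b - a) / b. *)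
Lemma ln_powRN_gain (R : realType) (p a b : R) : 0 < p -> 1 < a -> a <= b ->
  p * (b - a) / (b * ln b `^ (1 + p)) <= ln a `^ (- p) - ln b `^ (- p).
Proof.
move=> p0 a1 ab; have a0 : 0 < a by lra.
have b0 : 0 < b by lra.
have la : 0 < ln a by exact: ln_gt0.
have lab : ln a <= ln b by rewrite ler_ln ?posrE.
apply: le_trans (powRN_gain p0 la lab).
have L0 : 0 < ln b `^ (1 + p) by apply: powR_gt0; lra.
rewrite invfM mulrA ler_pM2r ?invr_gt0// -mulrA ler_pM2l//.
have := ln_le_subr1 (divr_gt0 a0 b0); rewrite ln_div ?posrE//.
by rewrite mulrBl divff ?gt_eqF//; lra.
Qed.

Lemma ln_powRN_anti (R : realType) (p a b : R) : 0 < p -> 1 < a -> a <= b ->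
  ln b `^ (- p) <= ln a `^ (- p).
Proof.
move=> p0 a1 ab; have b1 : 1 < b by exact: lt_le_trans ab.
rewrite !powRN lef_pV2 ?posrE ?powR_gt0 ?ln_gt0//.
apply: ge0_ler_powR; rewrite ?nnegrE ?(ltW p0) ?ln_ge0 ?(ltW a1) ?(ltW b1)//.
by rewrite ler_ln ?posrE//; lra.
Qed.

(** * From bounded weighted sums of squares to pointwise bounds *)

(* Multiplied by [Phi M.+1], the size of the variance of the sum up to [M.+1],
   these weights telescope. *)
Definition log_weight (R : realType) (p : R) (Phi : nat -> R) (M : nat) : R :=
  (ln (Phi M) `^ (- p) - ln (Phi M.+1) `^ (- p)) / Phi M.+1.

(** A block on which [|D|] stays above [delta] contributes at least [delta ^+ 2 / Phi b] times the
    drop of ln^(-p) [Phi] across it, and [ln_powRN_gain] bounds that drop below by the growth of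
    [Phi]. *)
Lemma block_bound (R : realType) (p Y delta : R) (Phi D : nat -> R)
    (n0 a b : nat) : 0 < p -> 0 <= delta -> (n0 <= a < b)%N ->
  1 < Phi n0 -> {homo Phi : m n / (m <= n)%N >-> m <= n} ->
  (forall n, \sum_(n0 <= M < n) log_weight p Phi M * D M.+1 ^+ 2 <= Y) ->
  (forall M, (a < M <= b)%N -> delta <= `|D M|) ->
  delta ^+ 2 * (p * (Phi b - Phi a)) <=
    Y * (Phi b ^+ 2 * ln (Phi b) `^ (1 + p)).
Proof.
move=> p0 d0 /andP[n0a ab] Phi1 Phim HY HD.
have Phin M : (n0 <= M)%N -> 1 < Phi M.
  by move=> n0M; apply: lt_le_trans Phi1 _; exact: Phim.
have decr M : (n0 <= M)%N -> ln (Phi M.+1) `^ (- p) <= ln (Phi M) `^ (- p).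
  by move=> n0M; rewrite ln_powRN_anti ?Phin ?Phim.
have b1 := Phin b (leq_trans n0a (ltnW ab)).
have a1 := Phin a n0a.
have Pb0 : 0 < Phi b by lra.
have L0 : 0 < ln (Phi b) `^ (1 + p) by rewrite powR_gt0// ln_gt0.
(* Terms before [a] are nonnegative and are dropped; inside the block [Phi M.+1 <= Phi b] makes the
   denominators uniform, and the differences telescope. *)
have S1 : (ln (Phi a) `^ (- p) - ln (Phi b) `^ (- p)) / Phi b * delta ^+ 2 <= Y.
  apply: le_trans (HY b).
  rewrite (big_cat_nat n0a (ltnW ab))/=.
  rewrite -[leLHS]add0r lerD//.
    rewrite big_nat_cond sumr_ge0// => M /andP[/andP[n0M Ma] _].
    rewrite mulr_ge0 ?sqr_ge0// divr_ge0 ?subr_ge0 ?decr//.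
    by apply: ltW; have := Phin _ (leqW n0M); lra.
  have -> : ln (Phi a) `^ (- p) - ln (Phi b) `^ (- p) =
      \sum_(a <= M < b) (ln (Phi M) `^ (- p) - ln (Phi M.+1) `^ (- p)).
    rewrite (telescope_sumr_eq (fun M => - ln (Phi M) `^ (- p))) ?(ltnW ab)//.
      by rewrite opprK addrC.
    by move=> M _; rewrite opprK addrC.
  rewrite !mulr_suml.
  rewrite [leLHS]big_nat_cond [leRHS]big_nat_cond.
  apply: ler_sum => M /andP[/andP[aM Mb] _].
  have n0M := leq_trans n0a aM.
  have M1 := Phin _ (leqW n0M).
  apply: ler_pM.
  - by rewrite divr_ge0 ?subr_ge0 ?decr// ltW.
  - exact: sqr_ge0.
  - rewrite /log_weight ler_wpM2l ?subr_ge0 ?decr//.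
    by rewrite lef_pV2 ?posrE ?Phim//; lra.
  (* The term of index [M] carries [D M.+1], so [a <= M < b] matches the range [a < M.+1 <= b] of
     the hypothesis. *)
  - rewrite -[leRHS]real_normK ?num_real// ler_sqr ?nnegrE//.
    by rewrite HD// Mb ltnS aM.
have S2 : delta ^+ 2 * (p * (Phi b - Phi a)) /
    (Phi b ^+ 2 * ln (Phi b) `^ (1 + p)) <= Y.
  apply: le_trans S1.
  have := ln_powRN_gain p0 a1 (Phim _ _ (ltnW ab)) => h.
  rewrite [leLHS](_ : _ = p * (Phi b - Phi a) /
    (Phi b * ln (Phi b) `^ (1 + p)) / Phi b * delta ^+ 2); last first.
    by field; rewrite !gt_eqF.
  by rewrite ler_wpM2r ?sqr_ge0// ler_wpM2r// invr_ge0 ltW.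
by rewrite -ler_pdivrMr// mulr_gt0// exprn_gt0.
Qed.

(** The claimed error for the sum, before division by [N], as a function of u = N + G(N). *)
Definition rate (R : realType) (eps u : R) : R :=
  u `^ (2 / 3) * ln u `^ (1 / 3 + eps).

Lemma rate_gt0 (R : realType) (eps u : R) : 1 < u -> 0 < rate eps u.
Proof.
by move=> u1; rewrite mulr_gt0// powR_gt0 ?ln_gt0//; exact: lt_trans u1.
Qed.

(** This explains the exponents 2/3 and 1/3: for [p = 3 * eps] the right side is the factor u^2
    ln^(1+p) u of [block_bound], so a block on which [Phi] grows by the rate e gives delta^2 e =
    O(e^3), that is delta = O(e). *)
Lemma rate_cubed (R : realType) (eps u : R) : 1 <= u ->
  rate eps u ^+ 3 = u ^+ 2 * ln u `^ (1 + 3 * eps).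
Proof.
move=> u1; have u0 : 0 <= u by lra.
rewrite exprMn -!powR_mulrn ?powR_ge0// -!powRrM.
by congr (_ `^ _ * _ `^ _); field.
Qed.

(** Powers of the logarithm are beaten by u^(1/6), so the rate is o(u). The half keeps [Phi]
    comparable with u after a change by one rate in either direction. *)
Lemma rate_le_half (R : realType) (eps : R) : 0 < eps ->
  exists u0 : R, forall u, u0 <= u -> rate eps u <= u / 2.
Proof.
move=> e0; set q := 1 / 3 + eps; have q0 : 0 < q by rewrite /q; lra.
(* With this [a], raising ln u <= u^a / a to the power [q] gives ln^q u <= c u^(1/6); the spare
   factor in u = u^(2/3) u^(1/6) u^(1/6) then absorbs [2 * c]. *)
set a := (6 * q)^-1; have a0 : 0 < a by rewrite invr_gt0; lra.
set c := (a^-1) `^ q; have c0 : 0 < c by rewrite powR_gt0// invr_gt0.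
exists (1 + (2 * c) `^ 6) => u uge.
have u1 : 1 <= u by have := powR_ge0 (2 * c) 6; lra.
have ug0 : 0 < u by lra.
have lnu : ln u <= a^-1 * u `^ a.
  rewrite ler_pdivlMl// -ln_powR.
  by have := ln_le_subr1 (powR_gt0 a ug0); lra.
have L : ln u `^ q <= c * u `^ (6^-1).
  have -> : 6^-1 = a * q by rewrite /a; field; rewrite gt_eqF.
  have ai0 : 0 <= a^-1 by rewrite invr_ge0 ltW.
  rewrite powRrM /c -powRM ?ai0 ?powR_ge0//.
  apply: ge0_ler_powR; rewrite ?(ltW q0) ?nnegrE ?ln_ge0//.
  by rewrite mulr_ge0 ?powR_ge0.
have c2 : 2 * c <= u `^ (6^-1).
  have -> : 2 * c = ((2 * c) `^ 6) `^ (6^-1).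
    by rewrite -powRrM divff ?powRr1//; lra.
  by apply: ge0_ler_powR; rewrite ?nnegrE ?powR_ge0 ?(ltW ug0)//; lra.
have uE : u = u `^ (2 / 3) * (u `^ (6^-1) * u `^ (6^-1)).
  rewrite -!powRD ?(gt_eqF ug0) ?implybT//.
  by rewrite [X in u `^ X](_ : _ = 1) ?powRr1 ?(ltW ug0)//; field.
rewrite /rate -/q [X in _ <= X / 2]uE -mulrA ler_wpM2l ?powR_ge0//.
rewrite (le_trans L)//.
by have := powR_gt0 (6^-1) ug0; nra.
Qed.

(* A large value of [D] persists over a block on which [Phi] grows by the rate:
   forward in time when [D N] is large and positive, backward when it is large
   and negative, since [D] decreases by at most [m] per step. *)
Lemma rate_of_log_square_sum (R : realType) (eps m C Y : R) (n0 : nat)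
    (Phi D : nat -> R) : 0 < eps -> 0 <= m -> 0 <= C ->
  1 < Phi n0 -> (forall M, M%:R <= Phi M) ->
  (forall M, Phi M + 1 <= Phi M.+1) ->
  (forall M, (n0 <= M)%N -> Phi M.+1 <= Phi M + C * Phi M `^ (2 / 3)) ->
  (forall M, D M - m <= D M.+1) ->
  (forall n,
    \sum_(n0 <= M < n) log_weight (3 * eps) Phi M * D M.+1 ^+ 2 <= Y) ->
  exists K, \forall N \near \oo, `|D N| <= K * rate eps (Phi N).
Proof.
move=> e0 m0 C0 Phi1 Phiinf Phistep Phijump Dstep HY.
have Phim : {homo Phi : i j / (i <= j)%N >-> i <= j}.
  apply: homo_leq => [//|? ? ?|M]; first exact: le_trans.
  by have := Phistep M; lra.
(* [Phi] grows by at least 1 per step, so the loss of [D] over a stretch of indices is at most [m]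
   times the growth of [Phi] there. *)
have Dm : {homo (fun M => D M + m * Phi M) : i j / (i <= j)%N >-> i <= j}.
  apply: homo_leq => [//|? ? ?|M]; first exact: le_trans.
  by have := Phistep M; have := Dstep M; nra.
have Y0 : 0 <= Y by have := HY n0; rewrite big_geq.
set p := 3 * eps in HY; have p0 : 0 < p by rewrite /p; lra.
(* [L * u] bounds [Phi] at the right end of each block; [Z] is the constant that [block_bound] then
   yields for (delta / e)^2. *)
pose L : R := 2 + 2 * C.
pose Z := Y * L ^+ 2 * 2 `^ (1 + p) / p.
have Z0 : 0 <= Z.
  by rewrite divr_ge0 ?(ltW p0)// mulr_ge0 ?powR_ge0// mulr_ge0// sqr_ge0.
have [u0 Hu0] := rate_le_half e0.
(* [1 + Z] comes from the block, the rest from the loss of [D] across it. *)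
exists (1 + Z + m * (1 + 2 * C)).
(* In order, the thresholds give e <= u / 2, 1 <= ln u, L u <= u^2 and [Phi n0 <= u - e]. *)
apply: filterS (nbhs_infty_ger
  (Num.max u0 (Num.max (expR 1) (Num.max L (2 * Phi n0))))) => N /=.
rewrite !ge_max => /and4P[/le_trans/(_ (Phiinf N)) hu0
  /le_trans/(_ (Phiinf N)) h3 /le_trans/(_ (Phiinf N)) hL
  /le_trans/(_ (Phiinf N)) hn0].
set u := Phi N in hu0 h3 hL hn0 *; set e := rate eps u.
have u1 : 1 < u by have := expR_ge1Dx (1 : R); lra.
have eg0 : 0 < e by exact: rate_gt0.
have eu : e <= u / 2 by exact: Hu0.
have ln1 : 1 <= ln u.
  by rewrite -[X in X <= _]expRK ler_ln ?posrE ?expR_gt0//; lra.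
have ue : u `^ (2 / 3) <= e.
  rewrite /e /rate ler_peMr ?powR_ge0//.
  have q0 : 0 <= 1 / 3 + eps by lra.
  by have := ler_powR ln1 q0; rewrite powRr0.
have e3 : e ^+ 3 = u ^+ 2 * ln u `^ (1 + p) by rewrite rate_cubed// ltW.
clearbody e.
(* Both signs of [D N] end here: one factor e of [rate_cubed] cancels against the growth of [Phi],
   which is at least e. *)
have blk a b delta : (n0 <= a < b)%N -> 0 <= delta -> e <= Phi b - Phi a ->
    Phi b <= L * u -> (forall M, (a < M <= b)%N -> delta <= `|D M|) ->
    delta <= (1 + Z) * e.
  move=> ab d0 eab bu HD.
  have b1 : 1 < Phi b.
    apply: lt_le_trans Phi1 _; apply: Phim.
    by case/andP: ab => ? /ltnW; exact: leq_trans.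
  have := block_bound p0 d0 ab Phi1 Phim HY HD => H.
  have lnb : ln (Phi b) <= 2 * ln u.
    rewrite -ln_powR powR_mulrn; last lra.
    rewrite ler_ln ?posrE//; first (apply: le_trans bu _; nra); nra.
  have P1 : ln (Phi b) `^ (1 + p) <= 2 `^ (1 + p) * ln u `^ (1 + p).
    rewrite -powRM//; last lra.
    by apply: ge0_ler_powR; rewrite ?nnegrE ?ln_ge0//; lra.
  have P2 : Phi b ^+ 2 * ln (Phi b) `^ (1 + p) <=
      L ^+ 2 * 2 `^ (1 + p) * e ^+ 3.
    rewrite e3 [leRHS](_ : _ = (L * u) ^+ 2 *
      (2 `^ (1 + p) * ln u `^ (1 + p))); last by ring.
    apply: ler_pM; rewrite ?sqr_ge0 ?powR_ge0// ler_sqr ?nnegrE//; lra.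
  have P3 : delta ^+ 2 * (p * e) <= Y * (L ^+ 2 * 2 `^ (1 + p) * e ^+ 3).
    apply: le_trans (ler_wpM2l Y0 P2); apply: le_trans H.
    by rewrite ler_wpM2l ?sqr_ge0// ler_pM2l.
  have P4 : delta ^+ 2 <= Z * e ^+ 2.
    have pe : 0 < p * e by exact: mulr_gt0.
    rewrite -(ler_pM2r pe) (le_trans P3)// le_eqVlt; apply/orP; left; apply/eqP.
    by rewrite /Z; field; rewrite gt_eqF.
  (* [Z <= (1 + Z) ^+ 2] replaces a square root. *)
  rewrite -ler_sqr ?nnegrE// ?mulr_ge0 ?(ltW eg0) ?addr_ge0//.
  apply: le_trans P4 _; rewrite exprMn ler_wpM2r ?sqr_ge0//; nra.
have [D0|D0] := leP 0 (D N).
- rewrite ger0_norm//.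
  have [small|big] := leP (D N) (m * (1 + 2 * C) * e).
    apply: le_trans small _; rewrite ler_wpM2r ?(ltW eg0)//; lra.
  (* The forward block ends at the first index where [Phi] has gained e. *)
  have ex : exists M, u + e <= Phi M.
    exists (Num.truncn (u + e)).+1; apply: le_trans (Phiinf _).
    exact/ltW/truncnS_gt.
  pose b := ex_minn ex.
  have [ub bmin] : u + e <= Phi b /\ forall M, u + e <= Phi M -> (b <= M)%N.
    by rewrite /b; case: ex_minnP.
  have Nb : (N < b)%N.
    rewrite ltnNge; apply/negP => /Phim; rewrite -/u; lra.
  (* Minimality puts [Phi] below u + e <= 2 u at the preceding index, so the last jump is at most C
     (2 u)^(2/3) <= 2 C e. *)
  have Pb : Phi b <= u + (1 + 2 * C) * e.
    move: Nb ub bmin; case: (b) => // b' Nb ub bmin.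
    have hb' : Phi b' < u + e.
      by rewrite ltNge; apply/negP => /bmin; rewrite ltnn.
    have b'1 : 1 < Phi b' by apply: lt_le_trans u1 _; exact: Phim.
    have n0b' : (n0 <= b')%N.
      rewrite leqNgt; apply/negP => /ltnW/Phim.
      have := Phim _ _ (Nb : N <= b')%N.
      by rewrite -/u; lra.
    have : Phi b' `^ (2 / 3) <= 2 * e.
      apply: (@le_trans _ _ ((2 * u) `^ (2 / 3))).
        by apply: ge0_ler_powR; rewrite ?nnegrE; lra.
      rewrite powRM; [|lra|lra].
      apply: ler_pM; rewrite ?powR_ge0//.
      by apply: ler1_powR; lra.
    by have := Phijump _ n0b'; nra.
  suff : D N - m * (1 + 2 * C) * e <= (1 + Z) * e by lra.
  have n0N : (n0 <= N)%N.
    by rewrite leqNgt; apply/negP => /ltnW/Phim; rewrite -/u; lra.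
  apply: (@blk N b).
  - by rewrite n0N.
  - lra.
  - by rewrite -/u; lra.
  - apply: le_trans Pb _; rewrite /L; nra.
  - move=> M /andP[NM Mb]; apply: le_trans (ler_norm _).
    have := Dm _ _ (ltnW NM); have := Phim _ _ Mb; rewrite /= -/u; nra.
- rewrite ltr0_norm//.
  have [small|big] := leP (- D N) (m * e).
    by apply: le_trans small _; rewrite ler_wpM2r ?(ltW eg0)//; nra.
  have n0N : (n0 <= N)%N.
    by rewrite leqNgt; apply/negP => /ltnW/Phim; rewrite -/u; lra.
  (* The backward block starts at the last index from [n0] on with [Phi] at most u - e; [n0] itself
     qualifies by the last threshold. Every later [M <= N] has [Phi M] within e of u, so there
     [- D M >= - D N - m * e]. *)
  have ex : exists M, (n0 <= M)%N && (Phi M <= u - e).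
    by exists n0; rewrite leqnn; lra.
  have ub M : (n0 <= M)%N && (Phi M <= u - e) -> (M <= N)%N.
    move=> /andP[_ h]; rewrite leqNgt; apply/negP => /ltnW/Phim.
    by rewrite -/u; lra.
  pose a := ex_maxn ex ub.
  have [n0a ae amax] : [/\ (n0 <= a)%N, Phi a <= u - e &
      forall M, (n0 <= M)%N && (Phi M <= u - e) -> (M <= a)%N].
    by rewrite /a; case: ex_maxnP => i /andP[].
  have aN : (a < N)%N.
    by rewrite ltnNge; apply/negP => /Phim; rewrite -/u; lra.
  have mCe : 0 <= m * C * e by rewrite !mulr_ge0// ltW.
  suff : - D N - m * e <= (1 + Z) * e by lra.
  apply: (@blk a N).
  - by rewrite n0a.
  - lra.
  - by rewrite -/u; lra.
  - rewrite -/u /L; nra.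
  - move=> M /andP[aM MN]; rewrite -normrN; apply: le_trans (ler_norm _).
    have hM : u - e < Phi M.
      rewrite ltNge; apply/negP => h; have := amax M.
      by rewrite h (leq_trans n0a (ltnW aM)) leqNgt aM => /(_ isT).
    have := Dm _ _ MN; rewrite /= -/u; nra.
Qed.

(** * Birkhoff sums and functions constant on the cells *)

Definition birkhoff_sum (X : Type) (R : realType) (T : X -> X) (f : X -> R)
    (n : nat) (x : X) : R :=
  \sum_(0 <= k < n) f (iter k T x).

Lemma birkhoff_sumSl (X : Type) (R : realType) (T : X -> X) (f : X -> R)
    (n : nat) (x : X) :
  birkhoff_sum T f n.+1 x = f x + birkhoff_sum T f n (T x).
Proof.
rewrite /birkhoff_sum big_nat_recl//=; congr (_ + _).
by apply: eq_bigr => k _; rewrite -iterSr.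
Qed.

Definition constant_on_cells (X Y : Type) (A : nat -> set X) (f : X -> Y) :=
  forall i x y, A i x -> A i y -> f x = f y.

(** Sets that contain every cell they meet form a sigma-algebra, and by disjointness it contains the
    cells; the fibres of [f] therefore belong to it. *)
Lemma measurable_wrt_constant (d : measure_display) (X : measurableType d)
    (R : realType) (A : nat -> set X) (f : X -> R) :
  measurable_partition A -> measurable_wrt A f -> constant_on_cells A f.
Proof.
move=> [_ tA UA] mf i x y Aix Aiy.
pose G := [set B : set X | forall j u v, A j u -> A j v -> B u -> B v].
have GA : <<s range A>> `<=` G.
  apply: smallest_sub.
    split.
    - by move=> j u v _ _ [].
    - move=> B GB j u v Aju Ajv [_ nBu]; split => // Bv.
      exact: nBu (GB j v u Ajv Aju Bv).
    - move=> F GF j u v Aju Ajv [k _ Fku]; exists k => //.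
      exact: (GF k j u v Aju Ajv Fku).
  move=> _ [k _ <-] j u v Aju Ajv Aku.
  have -> // : k = j.
  by apply: (tA k j I I); exists u.
have := mf measurableT _ (measurable_set1 (f x)); rewrite setTI => /GA.
by move=> /(_ i x y Aix Aiy erefl) /= ->.
Qed.

Lemma measurable_iter (d : measure_display) (X : measurableType d) (T : X -> X)
    (n : nat) :
  measurable_fun [set: X] T -> measurable_fun [set: X] (iter n T).
Proof.
move=> mT; elim: n => [|n IH]; first exact: measurable_id.
exact: measurableT_comp mT IH.
Qed.

Lemma measurable_birkhoff_sum (d : measure_display) (X : measurableType d)
    (R : realType) (T : X -> X) (f : X -> R) (n : nat) :
  measurable_fun [set: X] T -> measurable_fun [set: X] f ->
  measurable_fun [set: X] (birkhoff_sum T f n).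
Proof.
move=> mT mf; apply: measurable_sum => k.
exact: measurableT_comp mf (measurable_iter k mT).
Qed.

Lemma birkhoff_sum_ge0 (X : Type) (R : realType) (T : X -> X) (f : X -> R)
    (n : nat) (x : X) :
  (forall y, 0 <= f y) -> 0 <= birkhoff_sum T f n x.
Proof. by move=> f0; rewrite sumr_ge0. Qed.

Lemma integral_measure_preserving (d : measure_display) (X : measurableType d)
    (R : realType) (mu : {measure set X -> \bar R}) (T : X -> X)
    (F : X -> \bar R) :
  measure_preserving mu T -> measurable_fun [set: X] F ->
  (forall x, (0 <= F x)%E) ->
  (\int[mu]_x F (T x) = \int[mu]_x F x)%E.
Proof.
move=> [mT muT] mF F0.
have := @ge0_integral_pushforward _ _ X X R T mT mu setT F measurableT mF
  (fun x _ => F0 x).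
rewrite preimage_setT => <-; apply: eq_measure_integral => B mB _.
exact: muT.
Qed.

Lemma measure_preserving_iter (d : measure_display) (X : measurableType d)
    (R : realType) (mu : {measure set X -> \bar R}) (T : X -> X) (n : nat) :
  measure_preserving mu T -> measure_preserving mu (iter n T).
Proof.
move=> [mT muT]; split; first exact: measurable_iter.
elim: n => [//|n IH] B mB.
have -> : iter n.+1 T @^-1` B = iter n T @^-1` (T @^-1` B) by [].
rewrite IH; first exact: muT.
by rewrite -[X in measurable X]setTI; exact: mT.
Qed.

(** Used for the partition itself and for its preimages under [iter k T]. *)
Lemma ge0_integral_cells (d : measure_display) (X : measurableType d)
    (R : realType) (mu : {measure set X -> \bar R}) (A : nat -> set X)
    (B : set X) (F : X -> \bar R) :
  (forall i, measurable (A i)) -> trivIset [set: nat] A ->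
  \bigcup_i A i = [set: X] -> measurable B -> measurable_fun [set: X] F ->
  (forall x, (0 <= F x)%E) ->
  (\int[mu]_(x in B) F x = \sum_(0 <= i <oo) \int[mu]_(x in B `&` A i) F x)%E.
Proof.
move=> mA tA UA mB mF F0.
have BE : B = \bigcup_i (B `&` A i) by rewrite -setI_bigcupr UA setIT.
rewrite [in LHS]BE.
rewrite ge0_integral_bigcup//.
- by move=> k; exact: measurableI.
- exact: measurable_funTS.
- exact: trivIset_setIl.
Qed.

Lemma integral_constant_on (d : measure_display) (X : measurableType d)
    (R : realType) (mu : {measure set X -> \bar R}) (B : set X) (f : X -> R)
    (c : R) :
  measurable B -> (forall x, B x -> f x = c) ->
  (\int[mu]_(x in B) (f x)%:E = c%:E * mu B)%E.
Proof.
move=> mB fc; rewrite -integral_cst//; apply: eq_integral => x /set_mem Bx.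
by rewrite fc.
Qed.

(** * From mixing of the cells to the variance of Birkhoff sums *)

Lemma sum_measure_le (d : measure_display) (X : measurableType d)
    (R : realType) (mu : probability X R) (T : X -> X) (B C : set X)
    (N : nat) (b : R) :
  measure_preserving mu T -> measurable B -> measurable C ->
  ((0 < mu B)%E -> (0 < mu C)%E ->
    \sum_(0 <= n < N) (mixing_ratio mu T B C n - 1) <= b) ->
  (\sum_(0 <= n < N) mu (B `&` iter n T @^-1` C) <=
    (N%:R + b)%:E * (mu B * mu C))%E.
Proof.
move=> mpT mB mC H.
have mI n : measurable (iter n T @^-1` C).
  have [mT _] := measure_preserving_iter n mpT.
  by rewrite -[X in measurable X]setTI; exact: mT.
have muI n : mu (iter n T @^-1` C) = mu C.
  by have [_ ->] := measure_preserving_iter n mpT.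
(* The ratio bound says nothing about null sets, but with denominators cleared both sides vanish
   there, so the result can be summed over all cells. *)
have [B0|B0] := eqVneq (mu B) 0%E.
  rewrite B0 mul0e mule0 big1// => n _; apply/eqP.
  by rewrite eq_le measure_ge0 andbT -B0 le_measure ?inE//; exact: measurableI.
have [C0|C0] := eqVneq (mu C) 0%E.
  rewrite C0 !mule0 big1// => n _; apply/eqP.
  rewrite eq_le measure_ge0 andbT -C0 -(muI n) le_measure ?inE//.
  exact: measurableI.
have Bp : (0 < mu B)%E by rewrite lt0e B0 measure_ge0.
have Cp : (0 < mu C)%E by rewrite lt0e C0 measure_ge0.
have {H} := H Bp Cp.
have fB : mu B \is a fin_num by exact: fin_num_measure.
have fC : mu C \is a fin_num by exact: fin_num_measure.
have bp : 0 < fine (mu B) by rewrite fine_gt0// Bp ltey_eq fB.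
have cp : 0 < fine (mu C) by rewrite fine_gt0// Cp ltey_eq fC.
rewrite sumrB sumr_const_nat subn0 -mulr_suml => H.
have -> : (\sum_(0 <= n < N) mu (B `&` iter n T @^-1` C) =
    (\sum_(0 <= n < N) fine (mu (B `&` iter n T @^-1` C)))%:E)%E.
  rewrite -sumEFin; apply: eq_bigr => n _; rewrite fineK//.
  by apply: fin_num_measure; exact: measurableI.
rewrite -(fineK fB) -(fineK fC) -!EFinM lee_fin -ler_pdivrMr ?mulr_gt0//.
lra.
Qed.

Lemma cell_values (X : Type) (R : realType) (A : nat -> set X) (f : X -> R) :
  (forall x, 0 <= f x) -> constant_on_cells A f ->
  exists c : nat -> R, (forall j, 0 <= c j) /\ forall j x, A j x -> f x = c j.
Proof.
move=> f0 fA.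
have /choice[c Hc] (j : nat) :
    exists c : R, 0 <= c /\ forall x, A j x -> f x = c.
  have [[x Ajx]|nA] := pselect (exists x, A j x).
    by exists (f x); split => // y Ajy; exact: (fA j).
  (* An empty cell gets the default value 0, which keeps [c] nonnegative. *)
  by exists 0; split => // x Ajx; case: nA; exists x.
by exists c; split => j; have [] := Hc j.
Qed.

Definition cells_mixing_bound (d : measure_display) (X : measurableType d)
    (R : realType) (mu : probability X R) (T : X -> X) (A : nat -> set X)
    (g : nat -> R) : Prop :=
  forall i j N : nat, (1 <= N)%N -> (0 < mu (A i))%E -> (0 < mu (A j))%E ->
    \sum_(0 <= n < N.+1) (mixing_ratio mu T (A i) (A j) n - 1) <= g N.

Lemma ge0_integral_birkhoff_sum (d : measure_display) (X : measurableType d)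
    (R : realType) (mu : {measure set X -> \bar R}) (T : X -> X) (B : set X)
    (f : X -> R) (n : nat) :
  measurable_fun [set: X] T -> measurable B -> measurable_fun [set: X] f ->
  (forall x, 0 <= f x) ->
  (\int[mu]_(x in B) (birkhoff_sum T f n x)%:E =
   \sum_(0 <= k < n) \int[mu]_(x in B) (f (iter k T x))%:E)%E.
Proof.
move=> mT mB mf f0; rewrite -ge0_integral_sum//.
- by apply: eq_integral => x _; rewrite /birkhoff_sum -sumEFin.
- move=> k; apply: measurable_funTS; apply/measurable_EFinP.
  exact: measurableT_comp mf (measurable_iter k mT).
- by move=> k x _; rewrite lee_fin.
Qed.

(** With [f] equal to [c j] on [A j], the left side is the sum over j and k of c_j mu(A_i meet
    T^(-k) A_j). The mixing bound is one-sided; it survives the summation because the weights [c j]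
    are nonnegative. *)
Lemma integral_cell_birkhoff_sum_le (d : measure_display)
    (X : measurableType d) (R : realType) (mu : probability X R) (T : X -> X)
    (A : nat -> set X) (g : nat -> R) (f : X -> R) (i N : nat) :
  measure_preserving mu T -> measurable_partition A ->
  cells_mixing_bound mu T A g -> measurable_fun [set: X] f ->
  (forall x, 0 <= f x) -> constant_on_cells A f ->
  (1 <= N)%N -> 0 <= g N ->
  (\int[mu]_(x in A i) (birkhoff_sum T f N.+1 x)%:E <=
    (N.+1%:R + g N)%:E * (mu (A i) * \int[mu]_x (f x)%:E))%E.
Proof.
move=> mpT [mA tA UA] mix mf f0 fA N1 g0.
have [mT _] := mpT.
have [c [c0 fc]] := cell_values f0 fA.
have mEf : measurable_fun [set: X] (EFin \o f) by exact/measurable_EFinP.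
have mTA k j : measurable (iter k T @^-1` A j).
  by rewrite -[X in measurable X]setTI; exact: (measurable_iter k mT).
have intf B : measurable B ->
    (\int[mu]_(x in B) (f x)%:E = \sum_(0 <= j <oo) (c j)%:E * mu (B `&` A j))%E.
  move=> mB; rewrite (ge0_integral_cells mu mA tA UA mB mEf)//.
  apply: eq_eseriesr => j _; apply: integral_constant_on.
    exact: measurableI.
  by move=> x [_]; exact: fc.
have intfT k : (\int[mu]_(x in A i) (f (iter k T x))%:E =
    \sum_(0 <= j <oo) (c j)%:E * mu (A i `&` iter k T @^-1` A j))%E.
  (* The preimages of the cells under [iter k T] again form a partition, and f(T^k x) is constant on
     each of them. *)
  rewrite (@ge0_integral_cells _ _ _ mu (fun j => iter k T @^-1` A j))//.
  - apply: eq_eseriesr => j _.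
    apply: (@integral_constant_on _ _ _ _ _ (f \o iter k T)).
      exact: measurableI.
    by move=> x [_]; exact: fc.
  - move=> j l _ _ [x [Aj Al]]; apply: (tA j l I I).
    by exists (iter k T x).
  - by rewrite -preimage_bigcup UA preimage_setT.
  - exact: measurableT_comp mEf (measurable_iter k mT).
  - by move=> x; rewrite lee_fin.
rewrite ge0_integral_birkhoff_sum//.
under eq_bigr do rewrite intfT.
rewrite -nneseries_sum_nat; last by move=> k j; rewrite mule_ge0 ?lee_fin.
have -> : ((N.+1%:R + g N)%:E * (mu (A i) * \int[mu]_x (f x)%:E) =
    \sum_(0 <= j <oo) (c j)%:E * ((N.+1%:R + g N)%:E * (mu (A i) * mu (A j))))%E.
  rewrite intf// -[X in (_ * (X * _))%E](fineK (fin_num_measure mu _ (mA i))).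
  rewrite muleA -EFinM -nneseriesZl; last first.
    by move=> j _; rewrite mule_ge0 ?lee_fin.
  apply: eq_eseriesr => j _; rewrite setTI.
  by rewrite muleCA EFinM -muleA fineK ?fin_num_measure.
apply: lee_nneseries => j _.
  by move=> _; apply: sume_ge0 => k _; rewrite mule_ge0 ?lee_fin.
rewrite -ge0_sume_distrr; last by move=> k _; exact: measure_ge0.
by rewrite lee_wpmul2l ?lee_fin//; apply: sum_measure_le => //; exact: mix.
Qed.

(** The same weighting over the other index: [f] is [c i] on [A i], and the sum of c_i mu(A_i)
    supplies the second factor [m]. *)
Lemma integral_mul_birkhoff_sum_le (d : measure_display)
    (X : measurableType d) (R : realType) (mu : probability X R) (T : X -> X)
    (A : nat -> set X) (g : nat -> R) (f : X -> R) (m : R) (N : nat) :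
  measure_preserving mu T -> measurable_partition A ->
  cells_mixing_bound mu T A g -> measurable_fun [set: X] f ->
  (forall x, 0 <= f x) -> constant_on_cells A f ->
  (1 <= N)%N -> 0 <= g N -> (\int[mu]_x (f x)%:E = m%:E)%E ->
  (\int[mu]_x (f x * birkhoff_sum T f N.+1 x)%:E <=
    ((N.+1%:R + g N) * m ^+ 2)%:E)%E.
Proof.
move=> mpT pA mix mf f0 fA N1 g0 fm.
have [mT _] := mpT; have [mA tA UA] := pA.
have [c [c0 fc]] := cell_values f0 fA.
have mEf : measurable_fun [set: X] (EFin \o f) by exact/measurable_EFinP.
have mS := measurable_birkhoff_sum N.+1 mT mf.
rewrite (ge0_integral_cells mu mA tA UA)//; last 2 first.
- by apply/measurable_EFinP; exact: measurable_funM.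
- by move=> x; rewrite lee_fin mulr_ge0// birkhoff_sum_ge0.
have m0 : 0 <= m.
  by rewrite -lee_fin -fm integral_ge0// => x _; rewrite lee_fin.
apply: (@le_trans _ _ (\sum_(0 <= i <oo)
    ((N.+1%:R + g N) * m)%:E * ((c i)%:E * mu (A i)))%E).
  apply: lee_nneseries => i _.
    move=> _; apply: integral_ge0 => x _.
    by rewrite lee_fin mulr_ge0// birkhoff_sum_ge0.
  rewrite setTI.
  have -> : (\int[mu]_(x in A i) (f x * birkhoff_sum T f N.+1 x)%:E =
      (c i)%:E * \int[mu]_(x in A i) (birkhoff_sum T f N.+1 x)%:E)%E.
    rewrite -ge0_integralZl_EFin//; first last.
    - apply: measurable_funTS; exact/measurable_EFinP.
    - by move=> x _; rewrite lee_fin birkhoff_sum_ge0.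
    by apply: eq_integral => x /set_mem Ax; rewrite (fc i).
  rewrite muleCA; apply: lee_wpmul2l; first by rewrite lee_fin.
  have := integral_cell_birkhoff_sum_le i mpT pA mix mf f0 fA N1 g0.
  by rewrite fm [(mu (A i) * _)%E]muleC muleA -EFinM.
rewrite nneseriesZl; last by move=> i _; rewrite mule_ge0 ?lee_fin.
have -> : (\sum_(0 <= i <oo) (c i)%:E * mu (A i) = m%:E)%E.
  rewrite -fm (ge0_integral_cells mu mA tA UA _ mEf)//.
  apply: eq_eseriesr => i _; rewrite setTI; apply/esym.
  by apply: integral_constant_on => // x; exact: fc.
by rewrite -EFinM lee_fin -mulrA -expr2.
Qed.

Lemma integral_birkhoff_sum (d : measure_display) (X : measurableType d)
    (R : realType) (mu : {measure set X -> \bar R}) (T : X -> X) (f : X -> R)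
    (m : R) (n : nat) :
  measure_preserving mu T -> measurable_fun [set: X] f ->
  (forall x, 0 <= f x) -> (\int[mu]_x (f x)%:E = m%:E)%E ->
  (\int[mu]_x (birkhoff_sum T f n x)%:E = (n%:R * m)%:E)%E.
Proof.
move=> mpT mf f0 fm; have [mT _] := mpT.
rewrite ge0_integral_birkhoff_sum//.
have fk k : (\int[mu]_x (f (iter k T x))%:E = m%:E)%E.
  rewrite -fm (@integral_measure_preserving _ _ _ mu (iter k T) (EFin \o f))//.
  - exact: measure_preserving_iter.
  - exact/measurable_EFinP.
under eq_bigr do rewrite fk.
by rewrite sumEFin sumr_const_nat subn0 mulr_natl.
Qed.

(** Induction through S_(n+1) = f + S_n(T), whence S_(n+1)^2 = S_n(T)^2 + 2 f S_(n+1) - f^2. The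
    last term is discarded; invariance handles the first and the correlation bound the second. *)
Lemma integral_sqr_birkhoff_sum_le (d : measure_display)
    (X : measurableType d) (R : realType) (mu : probability X R) (T : X -> X)
    (A : nat -> set X) (g : nat -> R) (f : X -> R) (m V : R) (N : nat) :
  measure_preserving mu T -> measurable_partition A ->
  cells_mixing_bound mu T A g -> (forall n, (1 <= n)%N -> 0 <= g n) ->
  measurable_fun [set: X] f -> (forall x, 0 <= f x) ->
  constant_on_cells A f -> (\int[mu]_x (f x)%:E = m%:E)%E ->
  (\int[mu]_x (f x ^+ 2)%:E = V%:E)%E ->
  (\int[mu]_x (birkhoff_sum T f N.+1 x ^+ 2)%:E <=
    ((N.+1%:R * m) ^+ 2 + (V + 2 * m ^+ 2) * (N.+1%:R + Gsum g N))%:E)%E.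
Proof.
move=> mpT pA mix g0 mf f0 fA fm fV; have [mT _] := mpT.
have V0 : 0 <= V.
  by rewrite -lee_fin -fV integral_ge0// => x _; rewrite lee_fin sqr_ge0.
have mS n := measurable_birkhoff_sum n mT mf.
elim: N => [|N IH].
  rewrite /Gsum big_geq// addr0 mulr1 mul1r.
  rewrite (eq_integral (fun x => (f x ^+ 2)%:E)); last first.
    by move=> x _; rewrite /birkhoff_sum big_nat1.
  by rewrite fV lee_fin; have := sqr_ge0 m; lra.
have mS2 n : measurable_fun [set: X] (fun x => (birkhoff_sum T f n x ^+ 2)%:E).
  by apply/measurable_EFinP; exact: measurable_funX.
have mfS : measurable_fun [set: X] (fun x => (f x * birkhoff_sum T f N.+2 x)%:E).
  by apply/measurable_EFinP; exact: measurable_funM.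
apply: (@le_trans _ _ (\int[mu]_x ((birkhoff_sum T f N.+1 (T x) ^+ 2)%:E +
    2%:E * (f x * birkhoff_sum T f N.+2 x)%:E))%E).
  apply: ge0_le_integral => //.
  - by move=> x _; rewrite lee_fin sqr_ge0.
  - apply: emeasurable_funD; first exact: measurableT_comp (mS2 _) mT.
    exact: measurable_funeM.
  - move=> x _; rewrite -EFinM -EFinD lee_fin birkhoff_sumSl.
    by have := sqr_ge0 (f x); nra.
rewrite ge0_integralD//; first last.
- exact: measurable_funeM.
- by move=> x _; rewrite -EFinM lee_fin !mulr_ge0// birkhoff_sum_ge0.
- exact: measurableT_comp (mS2 _) mT.
- by move=> x _; rewrite lee_fin sqr_ge0.
rewrite (integral_measure_preserving mpT (mS2 N.+1)); last first.
  by move=> x; rewrite lee_fin sqr_ge0.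
rewrite ge0_integralZl_EFin//; last first.
  by move=> x _; rewrite lee_fin mulr_ge0// birkhoff_sum_ge0.
have gN := g0 N.+1 isT.
have H := integral_mul_birkhoff_sum_le mpT pA mix mf f0 fA (isT : (1 <= N.+1)%N) gN fm.
apply: le_trans (leeD IH (lee_wpmul2l (_ : (0 <= 2%:E)%E) H)) _ => //.
(* The increment 2 (N + 2 + g(N+1)) m^2 exceeds that of the squared mean by (1 + 2 g(N+1)) m^2,
   which (V + 2 m^2) (1 + g(N+1)) covers. *)
rewrite -EFinM -EFinD lee_fin /Gsum [in leRHS]big_nat_recr//= -!natr1.
have := sqr_ge0 m; have := mulr_ge0 V0 gN; nra.
Qed.

Lemma variance_birkhoff_sum_le (d : measure_display)
    (X : measurableType d) (R : realType) (mu : probability X R) (T : X -> X)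
    (A : nat -> set X) (g : nat -> R) (f : X -> R) (m V : R) (N : nat) :
  measure_preserving mu T -> measurable_partition A ->
  cells_mixing_bound mu T A g -> (forall n, (1 <= n)%N -> 0 <= g n) ->
  measurable_fun [set: X] f -> (forall x, 0 <= f x) ->
  constant_on_cells A f -> (\int[mu]_x (f x)%:E = m%:E)%E ->
  (\int[mu]_x (f x ^+ 2)%:E = V%:E)%E -> (1 <= N)%N ->
  (\int[mu]_x ((birkhoff_sum T f N x - N%:R * m) ^+ 2)%:E <=
    ((V + 2 * m ^+ 2) * (N%:R + Gsum g N))%:E)%E.
Proof.
case: N => [//|N] mpT pA mix g0 mf f0 fA fm fV _; have [mT _] := mpT.
have mS := measurable_birkhoff_sum N.+1 mT mf.
have m0 : 0 <= m.
  by rewrite -lee_fin -fm integral_ge0// => x _; rewrite lee_fin.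
have V0 : 0 <= V.
  by rewrite -lee_fin -fV integral_ge0// => x _; rewrite lee_fin sqr_ge0.
set a := N.+1%:R * m; have a0 : 0 <= a by rewrite mulr_ge0.
have mES : measurable_fun [set: X] (fun x => (birkhoff_sum T f N.+1 x)%:E).
  exact/measurable_EFinP.
(* The square expanded around the mean, with the cross term moved to the left so that all integrands
   are nonnegative and the integrals add freely. *)
have E : (\int[mu]_x ((birkhoff_sum T f N.+1 x - a) ^+ 2)%:E + (2 * a * a)%:E =
    \int[mu]_x (birkhoff_sum T f N.+1 x ^+ 2)%:E + (a ^+ 2)%:E)%E.
  have -> : ((a ^+ 2)%:E = \int[mu]_x (a ^+ 2)%:E)%E.
    rewrite integral_cst// -[LHS]mule1; congr (_ * _)%E.
    exact/esym/probability_setT.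
  have -> : ((2 * a * a)%:E =
      \int[mu]_x ((2 * a)%:E * (birkhoff_sum T f N.+1 x)%:E))%E.
    rewrite ge0_integralZl_EFin ?mulr_ge0//; last first.
      by move=> x _; rewrite lee_fin birkhoff_sum_ge0.
    by rewrite (integral_birkhoff_sum _ mpT mf f0 fm) -EFinM.
  rewrite -!ge0_integralD//.
  - by apply: eq_integral => x _; rewrite -EFinM -!EFinD; congr EFin; ring.
  - by move=> x _; rewrite lee_fin sqr_ge0.
  - by apply/measurable_EFinP; exact: measurable_funX.
  - by move=> x _; rewrite lee_fin sqr_ge0.
  - by move=> x _; rewrite lee_fin sqr_ge0.
  - by apply/measurable_EFinP; apply: measurable_funX; exact: measurable_funB.
  - by move=> x _; rewrite -EFinM lee_fin !mulr_ge0// birkhoff_sum_ge0.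
  - exact: measurable_funeM.
have H := integral_sqr_birkhoff_sum_le N mpT pA mix g0 mf f0 fA fm fV.
rewrite -/a in H.
rewrite -(leeD2rE _ _ (_ : (2 * a * a)%:E \is a fin_num))// E.
apply: le_trans (leeD2r _ H) _.
rewrite -!EFinD lee_fin.
have -> : Gsum g N.+1 = Gsum g N + g N.+1 by rewrite /Gsum big_nat_recr.
have := g0 N.+1 isT; have := sqr_ge0 m; nra.
Qed.

(** * Almost everywhere bounds *)

(** The variance bound cancels the denominator of the weight, so the integrals of the terms
    telescope to at most K ln^(-p) [Phi n0]. A nonnegative function with finite integral is finite
    almost everywhere. *)
Lemma ae_log_square_sum_bounded (d : measure_display) (X : measurableType d)
    (R : realType) (mu : {measure set X -> \bar R}) (Phi : nat -> R)
    (D : nat -> X -> R) (p K : R) (n0 : nat) :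
  0 < p -> 1 < Phi n0 -> {homo Phi : m n / (m <= n)%N >-> m <= n} ->
  (forall n, measurable_fun [set: X] (D n)) ->
  (forall n, (n0 < n)%N -> (\int[mu]_x (D n x ^+ 2)%:E <= (K * Phi n)%:E)%E) ->
  {ae mu, forall x, exists Y, forall n,
    \sum_(n0 <= M < n) log_weight p Phi M * D M.+1 x ^+ 2 <= Y}.
Proof.
move=> p0 Phi1 Phim mD varD.
have Phin M : (n0 <= M)%N -> 1 < Phi M.
  by move=> n0M; apply: lt_le_trans Phi1 _; exact: Phim.
have w0 M : (n0 <= M)%N -> 0 <= log_weight p Phi M.
  move=> n0M; rewrite divr_ge0 ?subr_ge0 ?ln_powRN_anti ?Phin ?Phim//.
  by have := Phin _ (leqW n0M); lra.
have K0 : 0 <= K.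
  have h : 0 <= K * Phi n0.+1.
    rewrite -lee_fin; apply: le_trans (varD n0.+1 (leqnn _)).
    by rewrite integral_ge0// => x _; rewrite lee_fin sqr_ge0.
  by rewrite -(@pmulr_lge0 _ (Phi n0.+1))//; have := Phin _ (leqnSn n0); lra.
pose t k x := log_weight p Phi (k + n0) * D (k + n0).+1 x ^+ 2.
have t0 k x : (0 <= (t k x)%:E)%E.
  by rewrite lee_fin mulr_ge0 ?sqr_ge0// w0// leq_addl.
have mt k : measurable_fun [set: X] (EFin \o t k).
  apply/measurable_EFinP; apply: measurable_funM => //.
  exact: measurable_funX.
pose F x := (\sum_(0 <= k <oo) (t k x)%:E)%E.
have mF : measurable_fun [set: X] F.
  by apply: (ge0_emeasurable_sum (h := fun k x => (t k x)%:E)) => // k _; exact: mt.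
have intt k : (\int[mu]_x (t k x)%:E <=
    (K * (ln (Phi (k + n0)) `^ (- p) - ln (Phi (k + n0).+1) `^ (- p)))%:E)%E.
  under eq_integral do rewrite EFinM.
  rewrite ge0_integralZl_EFin ?w0 ?leq_addl//; first last.
  - by apply/measurable_EFinP; exact: measurable_funX.
  - by move=> x _; rewrite lee_fin sqr_ge0.
  have h := varD (k + n0).+1 (leq_addl _ _ : (n0 <= k + n0)%N).
  have wk : (0 <= (log_weight p Phi (k + n0))%:E)%E.
    by rewrite lee_fin w0// leq_addl.
  apply: le_trans (lee_wpmul2l wk h) _.
  have Pk : 0 < Phi (k + n0).+1.
    by have := Phin _ (leqW (leq_addl k n0)); lra.
  rewrite -EFinM lee_fin /log_weight le_eqVlt; apply/orP; left; apply/eqP.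
  by field; rewrite gt_eqF.
have intF : (\int[mu]_x F x <= (K * ln (Phi n0) `^ (- p))%:E)%E.
  rewrite integral_nneseries//.
  apply: lime_le.
    by apply: is_cvg_nneseries => k _ _; exact: integral_ge0.
  apply: nearW => n.
  apply: (@le_trans _ _ (\sum_(0 <= k < n)
      (K * (ln (Phi (k + n0)) `^ (- p) - ln (Phi (k + n0).+1) `^ (- p)))%:E)%E).
    exact: lee_sum.
  rewrite sumEFin lee_fin -mulr_sumr ler_wpM2l//.
  rewrite (telescope_sumr_eq (fun k => - ln (Phi (k + n0)) `^ (- p)))//.
    by rewrite opprK addrC gerBl powR_ge0.
  by move=> k _; rewrite opprK addrC.
have iF : mu.-integrable [set: X] F.
  apply/integrableP; split => //.
  under eq_integral => x _.
    rewrite gee0_abs; last by apply: nneseries_ge0 => k _ _; exact: t0.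
    over.
  by apply: le_lt_trans intF _; rewrite ltry.
have := integrable_ae measurableT iF.
apply: filterS => x /(_ I) Fx; exists (fine (F x)) => n.
rewrite -lee_fin fineK//.
(* The sum below [n] consists of the first [n - n0] shifted terms; truncated subtraction makes both
   empty when n <= n0. *)
apply: le_trans (nneseries_lim_ge (m := 0) (n - n0) _); last first.
  by move=> k _ _; exact: t0.
rewrite sumEFin lee_fin -[X in \sum_(X <= _ < _) _]add0n big_addn.
by [].
Qed.

(** Nonnegativity of [f] enters twice: in the variance bound and in the one-sided step D_(n+1) >=
    D_n - m. *)
Lemma ge0_birkhoff_sum_rate (d : measure_display) (X : measurableType d)
    (R : realType) (mu : probability X R) (T : X -> X) (A : nat -> set X)
    (g : nat -> R) (f : X -> R) (m V C eps : R) :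
  measure_preserving mu T -> measurable_partition A ->
  cells_mixing_bound mu T A g -> (forall n, (1 <= n)%N -> 0 <= g n) ->
  (forall n, (1 <= n)%N ->
    `|g n.+1| <= C * (n%:R + Gsum g n) `^ (2 / 3)) ->
  measurable_fun [set: X] f -> (forall x, 0 <= f x) ->
  constant_on_cells A f -> (\int[mu]_x (f x)%:E = m%:E)%E ->
  (\int[mu]_x (f x ^+ 2)%:E = V%:E)%E -> 0 < eps ->
  {ae mu, forall x, exists K, \forall N \near \oo,
    `|birkhoff_sum T f N x - N%:R * m| <= K * rate eps (N%:R + Gsum g N)}.
Proof.
move=> mpT pA mix g0 gC mf f0 fA fm fV e0; have [mT _] := mpT.
pose Phi n := n%:R + Gsum g n.
have PhiS n : Phi n.+1 = Phi n + 1 + g n.+1.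
  by rewrite /Phi /Gsum big_nat_recr//= -natr1; ring.
have Phistep n : Phi n + 1 <= Phi n.+1.
  by rewrite PhiS; have := g0 n.+1 isT; lra.
have Phim : {homo Phi : i j / (i <= j)%N >-> i <= j}.
  apply: homo_leq => [//|? ? ?|n]; first exact: le_trans.
  by have := Phistep n; lra.
have Phige n : n%:R <= Phi n.
  rewrite /Phi lerDl /Gsum big_nat_cond sumr_ge0// => k.
  by rewrite andbT => /andP[k1 _]; exact: g0.
(* Starting at index 2 makes [ln (Phi n)] positive throughout. *)
have Phi1 : 1 < Phi 2%N by apply: lt_le_trans (Phige _); rewrite ltr1n.
have m0 : 0 <= m.
  by rewrite -lee_fin -fm integral_ge0// => x _; rewrite lee_fin.
have C0 : 0 <= C.
  have P1 : 0 < Phi 1%N `^ (2 / 3) by rewrite powR_gt0// (lt_le_trans _ (Phige _)).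
  by rewrite -(pmulr_lge0 _ P1); apply: le_trans (gC 1%N isT).
pose D n x := birkhoff_sum T f n x - n%:R * m.
have mD n : measurable_fun [set: X] (D n).
  by apply: measurable_funB => //; exact: measurable_birkhoff_sum.
have p0 : 0 < 3 * eps by lra.
have := @ae_log_square_sum_bounded _ _ _ mu Phi D (3 * eps) (V + 2 * m ^+ 2) 2
  p0 Phi1 Phim mD.
have varD n : (2 < n)%N ->
    (\int[mu]_x (D n x ^+ 2)%:E <= ((V + 2 * m ^+ 2) * Phi n)%:E)%E.
  move=> n2; apply: (variance_birkhoff_sum_le mpT pA mix g0 mf f0 fA fm fV).
  exact: leq_trans n2.
move=> /(_ varD); apply: filterS => x [Y HY].
(* The step of [Phi] is [1 + g n.+1]; the extra 1 is absorbed because [Phi n] to the power 2/3 is at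
   least 1. *)
have C10 : 0 <= C + 1 by lra.
apply: (rate_of_log_square_sum e0 m0 C10 Phi1 Phige Phistep _ _ HY).
- move=> n n2; have n1 : (1 <= n)%N by exact: leq_trans n2.
  have Pn : 1 <= Phi n `^ (2 / 3).
    have h : 1 <= Phi n by apply: le_trans (Phige _); rewrite ler1n.
    have q0 : (0 : R) <= 2 / 3 by lra.
    by have := ler_powR h q0; rewrite powRr0.
  have := le_trans (ler_norm _) (gC n n1); rewrite PhiS -/(Phi n); lra.
- move=> n; rewrite /D /birkhoff_sum big_nat_recr//= -natr1.
  by have := f0 (iter n T x); lra.
Qed.

(** * Reduction of a signed function to its positive and negative parts *)

Theorem corollary2 (d : measure_display) (X : measurableType d) (R : realType)
    (mu : probability X R) (T : X -> X) (A : nat -> set X) (g : nat -> R)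
    (f : X -> R) :
  measure_preserving mu T ->
  measurable_partition A ->
  (forall N : nat, (1 <= N)%N -> 0 <= g N) ->
  g =o_\oo (fun N : nat => N%:R : R) ->
  (forall i j N : nat, (1 <= N)%N ->
    (0 < mu (A i))%E -> (0 < mu (A j))%E ->
    \sum_(0 <= n < N.+1) (mixing_ratio mu T (A i) (A j) n - 1) <= g N) ->
  f \in Lfun mu 2%:E ->
  measurable_wrt A f ->
  (exists C : R, forall N : nat, (1 <= N)%N ->
    `|g N.+1| <= C * (N%:R + Gsum g N) `^ (2 / 3)) ->
  forall eps : R, 0 < eps ->
  {ae mu, forall x : X,
    (fun N : nat => birkhoff_average T f x N - \int[mu]_(y in [set: X]) f y)
    =O_\oo
    (fun N : nat => N%:R^-1 * (N%:R + Gsum g N) `^ (2 / 3)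
                    * ln (N%:R + Gsum g N) `^ (1 / 3 + eps))}.
Proof.
move=> mpT pA g0 _ mix Lf /(measurable_wrt_constant pA) fA [C gC] eps e0.
have mf : measurable_fun [set: X] f.
  by move: Lf; rewrite inE => /andP[+ _]; rewrite inE.
have if2 := Lfun2_integrable_sqr Lf.
have if1 : mu.-integrable [set: X] (EFin \o f).
  apply/Lfun1_integrable; apply: Lfun_subset12 Lf.
  exact: fin_num_measure.
(* Domination by [|f|] makes h and h^2 integrable, so their integrals are finite numbers that can
   serve as [m] and [V]. *)
have part (h : X -> R) : measurable_fun [set: X] h -> (forall x, 0 <= h x) ->
    (forall x, h x <= `|f x|) -> constant_on_cells A h ->
    mu.-integrable [set: X] (EFin \o h) /\
    {ae mu, forall x, exists K, \forall N \near \oo,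
      `|birkhoff_sum T h N x - N%:R * \int[mu]_y h y| <=
        K * rate eps (N%:R + Gsum g N)}.
  move=> mh h0 hf hA.
  have ih1 : mu.-integrable [set: X] (EFin \o h).
    apply: le_integrable if1 => //; first exact/measurable_EFinP.
    by move=> x _ /=; rewrite lee_fin ger0_norm.
  have ih2 : mu.-integrable [set: X] (EFin \o (fun x => h x ^+ 2)).
    apply: le_integrable if2 => //.
      by apply/measurable_EFinP; exact: measurable_funX.
    move=> x _ /=; rewrite lee_fin !normrX ler_sqr ?nnegrE//.
    by rewrite ger0_norm.
  split=> //; have := @ge0_birkhoff_sum_rate _ _ _ mu T A g h
    (\int[mu]_y h y) (\int[mu]_y (h y ^+ 2)) C eps.
  apply=> //; rewrite /Rintegral fineK//; exact: integrable_fin_num.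
pose fp x := Num.max (f x) 0; pose fn x := Num.max (- f x) 0.
have [||||ip aep] := part fp.
- by apply: measurable_maxr.
  - by move=> x; rewrite le_max lexx orbT.
  - by move=> x; rewrite ge_max ler_norm normr_ge0.
  - by move=> i x y Ax Ay; rewrite /fp (fA i x y).
have [||||inn aen] := part fn.
  - by apply: measurable_maxr => //; exact: measurableT_comp.
  - by move=> x; rewrite le_max lexx orbT.
  - by move=> x; rewrite ge_max -normrN ler_norm normr_ge0.
  - by move=> i x y Ax Ay; rewrite /fn (fA i x y).
have fE x : f x = fp x - fn x.
  by rewrite /fp /fn; case: (leP (f x) 0); case: (leP (- f x) 0); lra.
have mE : \int[mu]_y f y = \int[mu]_y fp y - \int[mu]_y fn y.
  by rewrite -RintegralB//; apply: eq_Rintegral => y _.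
have SE N x : birkhoff_sum T f N x = birkhoff_sum T fp N x - birkhoff_sum T fn N x.
  by rewrite /birkhoff_sum -sumrB; apply: eq_bigr.
move: aep aen; apply: filterS2 => x [K1 H1] [K2 H2].
(* The witness must be positive, while the signs of [K1] and [K2] are unknown. *)
apply/eqO_exP; exists (1 + `|K1| + `|K2|).
  by have := normr_ge0 K1; have := normr_ge0 K2; lra.
near=> N.
have N1 : (1 <= N)%N by near: N; exact: nbhs_infty_ge.
have N0 : 0 < N%:R :> R by rewrite ltr0n.
have h1 : `|birkhoff_sum T fp N x - N%:R * \int[mu]_y fp y| <=
    K1 * rate eps (N%:R + Gsum g N) by near: N; exact: H1.
have h2 : `|birkhoff_sum T fn N x - N%:R * \int[mu]_y fn y| <=
    K2 * rate eps (N%:R + Gsum g N) by near: N; exact: H2.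
have r0 : 0 <= rate eps (N%:R + Gsum g N) by rewrite mulr_ge0 ?powR_ge0.
rewrite -mulrA -/(rate eps _) [X in _ <= _ * X]ger0_norm ?mulr_ge0 ?invr_ge0 ?powR_ge0//.
have -> : birkhoff_average T f x N - \int[mu]_y f y =
    N%:R^-1 * ((birkhoff_sum T fp N x - N%:R * \int[mu]_y fp y) -
               (birkhoff_sum T fn N x - N%:R * \int[mu]_y fn y)).
  rewrite /birkhoff_average -/(birkhoff_sum T f N x) SE mE.
  by field; rewrite gt_eqF.
rewrite normrM ger0_norm ?invr_ge0 ?ler0n// mulrCA ler_wpM2l ?invr_ge0 ?ler0n//.
apply: le_trans (ler_normB _ _) _.
apply: le_trans (lerD h1 h2) _; rewrite -mulrDl ler_wpM2r//.
by have := ler_norm K1; have := ler_norm K2; lra.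
Unshelve. all: by end_near.
Qed.
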